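(* Let $G$ be the group of order 18 presented by generators $x_1,x_2,a$ and relations $a^2=1$, $x_1^3=x_2^3=1$, $x_1x_2=x_2x_1$, $a x_i a^{-1}=x_i^{-1}$ $(i=1,2)$. A complete list of representatives of the dual of $G$ (that is, a list of irreducible complex representations of $G$ containing exactly one member of each equivalence class) is given by (1) the two one-dimensional irreducible representations $\Pi_{0,0;k}$, $k=0,1$; (2) the four two-dimensional irreducible representations $\Pi_{m_1,m_2}$ with $(m_1,m_2)\in\{(1,1),(1,0),(1,-1),(0,1)\}$.
   Context: Let $\omega=\exp(2\pi i/3)$. Put $U=\langle x_1\rangle\times\langle x_2\rangle\cong C_3\times C_3$ and $W=\langle w\rangle$ with $w=a$, so that $G=U\rtimes W$ with $W\cong C_2$. For $m_1,m_2\in\{-1,0,1\}$ (mod 3), $\rho_{m_1,m_2}$ is the one-dimensional character of $U$ with $\rho_{m_1,m_2}(x_k)=\omega^{m_k}$ $(k=1,2)$. For $k=0,1$, $\Pi_{0,0;k}={\bf 1}_U\cdot(\mathrm{sgn}_W)^k$ is the one-dimensional representation of $G$ trivial on $U$ and equal to $(\mathrm{sgn}_W)^k$ on $W$, where $\mathrm{sgn}_W(w)=-1$. For $(m_1,m_2)\neq(0,0)$, $\Pi_{m_1,m_2}=\mathrm{Ind}_U^G\,\rho_{m_1,m_2}$; in matrix form, $\Pi_{m_1,m_2}(u)=\mathrm{diag}(\rho_{m_1,m_2}(u),\rho_{-m_1,-m_2}(u))$ for $u\in U$ and $\Pi_{m_1,m_2}(w)=\begin{bmatrix}0&1\\1&0\end{bmatrix}$.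 *)

(* Defs.v *)
From HB Require Import structures.
From mathcomp Require Import all_boot all_order all_algebra all_fingroup.
From mathcomp Require Import all_solvable mxrepresentation.
From mathcomp Require Import complex.
From mathcomp Require Import reals sequences exp trigo.
From mathcomp Require Import ring.

Set Implicit Arguments.
Unset Strict Implicit.
Unset Printing Implicit Defensive.

Import Order.TTheory GRing.Theory Num.Theory GroupScope.

Local Open Scope ring_scope.

(* The notation [G \isog Grp (...)] does not name the images of the           *)
(* generators: the first fields say that x1, x2, a generate G and satisfy the *)
(* relations, the last one that these relations are defining relations of G.  *)
Record presented_by (gT : finGroupType) (G : {group gT}) (x1 x2 a : gT) :
    Prop := PresentedBy {
  pres_gen : G = <<[set x1; x2; a]>> :> {set gT};
  pres_a2 : (a ^+ 2 = 1)%g;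
  pres_x13 : (x1 ^+ 3 = 1)%g;
  pres_x23 : (x2 ^+ 3 = 1)%g;
  pres_x12 : (x1 * x2 = x2 * x1)%g;
  pres_ax1 : (a * x1 * a^-1 = x1^-1)%g;
  pres_ax2 : (a * x2 * a^-1 = x2^-1)%g;
  pres_iso : G \isog Grp (y1 : y2 : b :
    b ^+ 2, y1 ^+ 3, y2 ^+ 3, y1 * y2 = y2 * y1,
    b * y1 * b^-1 = y1^-1, b * y2 * b^-1 = y2^-1) }.

Definition Ugrp (gT : finGroupType) (x1 x2 : gT) : {group gT} :=
  (<[x1]> <*> <[x2]>)%G.
Definition Wgrp (gT : finGroupType) (a : gT) : {group gT} := <[a]>%G.

Section Relations.

Variables (gT : finGroupType) (G : {group gT}) (x1 x2 a : gT).
Local Notation U := (Ugrp x1 x2).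
Local Notation W := (Wgrp a).

Hypothesis genG : G = <<[set x1; x2; a]>> :> {set gT}.
Hypothesis a2 : (a ^+ 2 = 1)%g.
Hypothesis x13 : (x1 ^+ 3 = 1)%g.
Hypothesis x23 : (x2 ^+ 3 = 1)%g.
Hypothesis x12 : (x1 * x2 = x2 * x1)%g.
Hypothesis ax1 : (a * x1 * a^-1 = x1^-1)%g.
Hypothesis ax2 : (a * x2 * a^-1 = x2^-1)%g.

Let aV : (a^-1 = a)%g.
Proof. exact: mulg1_eq a2. Qed.

Lemma UgrpE : U = (<[x1]> * <[x2]>)%g :> {set gT}.
Proof. by rewrite /= cent_joinEr // centsC cents_cycle. Qed.

Lemma conj_U u : u \in U -> (a * u * a^-1 = u^-1)%g.
Proof.
rewrite UgrpE => /mulsgP[_ _ /cycleP[i ->] /cycleP[j ->] ->].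
have aJ y : (a * y * a^-1 = y ^ a^-1)%g by rewrite /conjg invgK mulgA.
rewrite aJ conjMg !conjXg -!aJ ax1 ax2 invMg !expgVn.
by apply: commuteV; apply/commute_sym/commuteV/commuteX2.
Qed.

Lemma Wgrp_norm : W \subset 'N(U).
Proof.
rewrite cycle_subG -groupV inE; apply/subsetP=> _ /imsetP[u Uu ->].
by rewrite /conjg invgK mulgA conj_U ?groupV.
Qed.

Lemma GrelE : G = (U * W)%g :> {set gT}.
Proof.
rewrite -norm_joinEr ?Wgrp_norm //= genG /cycle joing_idr.
by rewrite (joing_idl [set x1]) joing_idr [[set x1] <*> _]/joing joing_idl.
Qed.

Lemma card_rel_le : (#|G| <= #|U| * 2)%N /\ (#|U| <= 9)%N.
Proof.
have leM (A B : {group gT}) : (#|(A * B)%g| <= #|A| * #|B|)%N.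
  by rewrite mul_cardG leq_pmulr ?cardG_gt0.
split.
  rewrite GrelE (leq_trans (leM _ _)) // leq_mul2l.
  by rewrite -[#|W|]/#[a]%g dvdn_leq ?orbT // order_dvdn a2.
rewrite UgrpE (leq_trans (leM _ _)) // (@leq_mul _ _ 3 3) //.
  by rewrite dvdn_leq // order_dvdn x13.
by rewrite dvdn_leq // order_dvdn x23.
Qed.

End Relations.

(* A concrete model, acting on (Z/3)^2 by translations and negation.          *)
Section Model.

Local Notation T := ('Z_3 * 'Z_3)%type.

Definition trans_perm (e : T) : {perm T} := perm (@addIr _ e).
Definition neg_perm : {perm T} := perm (@oppr_inj T).

Let t1 := trans_perm (1, 0).
Let t2 := trans_perm (0, 1).
Let M : {group {perm T}} := <<[set t1; t2; neg_perm]>>%G.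

Let T_3 (e : T) : e + e + e = 0.
Proof. by case: e => [[[|[|[|?]]] ?] [[|[|[|?]]] ?]]; apply/eqP. Qed.

Let tr_3 e : (trans_perm e ^+ 3 = 1)%g.
Proof.
apply/permP=> p; rewrite permX /= !permE -[LHS]addrA -[LHS]addrA.
by rewrite [e + _]addrA T_3 addr0.
Qed.

Let neg_2 : (neg_perm ^+ 2 = 1)%g.
Proof. by apply/permP=> p; rewrite permX /= !permE opprK. Qed.

Let neg_inv : (neg_perm^-1 = neg_perm)%g.
Proof. exact: mulg1_eq neg_2. Qed.

Let tr_C e f : (trans_perm e * trans_perm f = trans_perm f * trans_perm e)%g.
Proof. by apply/permP=> p; rewrite !permM !permE addrAC. Qed.

Let neg_tr e : (neg_perm * trans_perm e * neg_perm^-1 = (trans_perm e)^-1)%g.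
Proof.
apply/esym/mulg1_eq/permP=> p; rewrite neg_inv !permM !permE.
by rewrite !opprD !opprK addrK.
Qed.

Let card_M_dvd : (18 %| #|M|)%N.
Proof.
have Mt1 : t1 \in M by rewrite mem_gen // !inE eqxx.
have Mt2 : t2 \in M by rewrite mem_gen // !inE eqxx orbT.
have Mn : neg_perm \in M by rewrite mem_gen // !inE eqxx !orbT.
rewrite (@Gauss_dvd 2 9) //; apply/andP; split.
  suff o2: #[neg_perm]%g = 2%N by have := order_dvdG Mn; rewrite o2.
  apply: nt_prime_order => //; apply/eqP=> /permP/(_ (1, 0)).
  by rewrite !permE => /eqP.
have orbT : orbit 'P M (0 : T) = setT.
  apply/setP=> -[i j]; rewrite inE; apply/orbitP.
  exists (t1 ^+ i * t2 ^+ j)%g; first by rewrite groupM ?groupX.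
  rewrite /= apermE permM !permX.
  have iterE e p n : iter n (trans_perm e) p = p + e *+ n.
    by elim: n => [|n IHn] /=; rewrite ?addr0 // permE IHn -addrA mulrSr.
  rewrite !iterE add0r; case: i j => [[|[|[|?]]] ?] [[|[|[|?]]] ?] //;
  by apply/eqP.
have := dvdn_orbit 'P M (0 : T).
by rewrite orbT cardsT card_prod !card_ord.
Qed.

Let M_homg (gT : finGroupType) (G : {group gT}) (x1 x2 a : gT) :
  presented_by G x1 x2 a -> M \homg G.
Proof.
case=> _ _ _ _ _ _ _ ->; apply/existsP; exists (t1, t2, neg_perm).
rewrite /= !xpair_eqE /= !tr_3 neg_2 !neg_tr !eqxx !andbT /= tr_C eqxx andbT.
rewrite /cycle joing_idr.
by rewrite (joing_idl [set t1]) joing_idr [[set t1] <*> _]/joing joing_idl.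
Qed.

Lemma presented_card (gT : finGroupType) (G : {group gT}) (x1 x2 a : gT) :
  presented_by G x1 x2 a -> #|G| = 18%N.
Proof.
move=> pG; have := dvdn_trans card_M_dvd (card_homg (M_homg pG)).
move/(dvdn_leq (cardG_gt0 G)).
case: pG => gG a2 x13 x23 x12 ax1 ax2 _.
have [leG leU] := card_rel_le gG a2 x13 x23 x12 ax1 ax2.
move=> le18; apply/eqP; rewrite eqn_leq le18 andbT (leq_trans leG) //.
by rewrite (leq_mul leU (leqnn 2)).
Qed.

Lemma presented_exists :
  exists (gT : finGroupType) (G : {group gT}) (x1 x2 a : gT),
    presented_by G x1 x2 a.
Proof.
exists {perm T}, M, t1, t2, neg_perm.
split; rewrite ?tr_3 ?neg_2 ?neg_tr //.
  exact: tr_C.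
apply: intro_isoGrp.
  apply/existsP; exists (t1, t2, neg_perm).
  rewrite /= !xpair_eqE /= !tr_3 neg_2 !neg_tr !eqxx !andbT /= tr_C eqxx andbT.
  rewrite /cycle joing_idr.
  by rewrite (joing_idl [set t1]) joing_idr [[set t1] <*> _]/joing joing_idl.
move=> rT H /existsP[[[y1 y2] b]] /= /eqP[defH b2 y13 y23 y12 by1 by2].
have {}defH : H = <<[set y1; y2; b]>> :> {set rT}.
  rewrite -defH /cycle joing_idr.
  by rewrite (joing_idl [set y1]) joing_idr [[set y1] <*> _]/joing joing_idl.
pose z1 := (t1, y1); pose z2 := (t2, y2); pose c := (neg_perm, b).
pose K : {group {perm T} * rT} := <<[set z1; z2; c]>>%G.
have pair_eq (u v : {perm T} * rT) : u.1 = v.1 -> u.2 = v.2 -> u = v.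
  by case: u v => ? ? [? ?] /= -> ->.
have [] := @card_rel_le _ K z1 z2 c.
- by [].
- by apply: pair_eq => //; exact: neg_2.
- by apply: pair_eq => //; exact: tr_3.
- by apply: pair_eq => //; exact: tr_3.
- by apply: pair_eq => //; exact: tr_C.
- by apply: pair_eq => //; exact: neg_tr.
- by apply: pair_eq => //; exact: neg_tr.
move=> leK leU.
have K18 : (#|K| <= 18)%N by rewrite (leq_trans leK) // (leq_mul leU (leqnn 2)).
have homMK : M \homg K.
  suff <-: (fst_morphism {perm T} rT @* K = M)%g.
    by rewrite morphim_homg ?subsetT.
  rewrite morphim_gen ?subsetT //.
  by rewrite morphimEsub ?subsetT // !imsetU !imset_set1.
have homHK : H \homg K.
  suff <-: (snd_morphism {perm T} rT @* K = H)%g.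
    by rewrite morphim_homg ?subsetT.
  rewrite defH morphim_gen ?subsetT //.
  by rewrite morphimEsub ?subsetT // !imsetU !imset_set1.
apply: homg_trans homHK _.
have: M \isog K by rewrite isogEcard homMK (leq_trans K18) // dvdn_leq.
by rewrite isogEhom => /andP[].
Qed.

End Model.

Section Structure.

Variables (gT : finGroupType) (G : {group gT}) (x1 x2 a : gT).
Hypothesis pG : presented_by G x1 x2 a.
Local Notation U := (Ugrp x1 x2).
Local Notation W := (Wgrp a).

Lemma presented_GE : G = (U * W)%g :> {set gT}.
Proof. by case: pG => *; apply: GrelE. Qed.

Lemma presented_UE : U = (<[x1]> * <[x2]>)%g :> {set gT}.
Proof. by case: pG => *; apply: UgrpE. Qed.

Lemma presented_conj u : u \in U -> (a * u * a^-1 = u^-1)%g.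
Proof. by case: pG => _ a2 x13 x23 x12 ax1 ax2 _; apply: conj_U. Qed.

Lemma presented_aV : (a^-1 = a)%g.
Proof. by apply: mulg1_eq; case: pG. Qed.

Let card_le :
  [/\ (#|U| <= 9)%N, (#[x1]%g <= 3)%N, (#[x2]%g <= 3)%N & (#[a]%g <= 2)%N].
Proof.
case: pG => gG a2 x13 x23 x12 ax1 ax2 _; split.
- by case: (card_rel_le gG a2 x13 x23 x12 ax1 ax2).
- by rewrite dvdn_leq // order_dvdn x13.
- by rewrite dvdn_leq // order_dvdn x23.
- by rewrite dvdn_leq // order_dvdn a2.
Qed.

Let card_eq : #|U| = 9%N /\ (U :&: W = 1)%g.
Proof.
have [leU _ _ lea] := card_le; have le2 : (#|W| <= 2)%N := lea.
have := mul_cardG U W; rewrite -presented_GE (presented_card pG) => e.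
have I0 := cardG_gt0 (U :&: W)%G.
have arith u w i : (u * w = 18 * i -> u <= 9 -> w <= 2 -> 0 < i ->
    u = 9 /\ i = 1)%N.
  move=> e' leu lew i0; have : (18 * i <= 9 * 2)%N by rewrite -e' leq_mul.
  rewrite -[(9 * 2)%N]/(18 * 1)%N leq_pmul2l // => i1.
  have i1E : i = 1%N by apply/eqP; rewrite eqn_leq i1.
  split=> //; apply/eqP; rewrite eqn_leq leu -(@leq_pmul2r 2) //.
  move: e'; rewrite i1E muln1 -[18%N]/(9 * 2)%N => <-.
  by rewrite leq_mul2l lew orbT.
have [U9 I1] := arith _ _ _ e leU le2 I0.
by split=> //; apply/card_le1_trivg/eq_leq.
Qed.

Lemma presented_tiUW : (U :&: W = 1)%g. Proof. by case: card_eq. Qed.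

Lemma presented_tix : (<[x1]> :&: <[x2]> = 1)%g.
Proof.
have [U9 _] := card_eq; have [_ le1 le2 _] := card_le.
have := mul_cardG <[x1]> <[x2]>; rewrite -presented_UE U9 => e.
apply/card_le1_trivg; rewrite -(leq_pmul2l (isT : 0 < 9)%N) -e.
by rewrite (leq_mul le1 le2).
Qed.

Lemma presented_order : #[x1]%g = 3%N /\ #[x2]%g = 3%N.
Proof.
have [U9 _] := card_eq; have [_ le1 le2 _] := card_le.
have e : (#[x1]%g * #[x2]%g = 3 * 3)%N.
  by rewrite -[RHS]U9 presented_UE TI_cardMg // presented_tix.
have arith (m n : nat) : (m * n = 3 * 3)%N -> (m <= 3)%N -> (n <= 3)%N ->
    m = 3%N.
  move=> e' lem len; apply/eqP; rewrite eqn_leq lem -(@leq_pmul2r 3) // -e'.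
  by rewrite leq_mul2l len orbT.
by split; [apply: arith e le1 le2 | apply: (arith _ #[x1]%g); rewrite // mulnC].
Qed.

Lemma presented_sdprod : (U ><| W = G)%g.
Proof.
rewrite sdprodE ?presented_tiUW ?presented_GE //.
by case: pG => *; apply: Wgrp_norm.
Qed.

Lemma presented_sUG : U \subset G.
Proof. by rewrite presented_GE mulG_subl. Qed.

Lemma presented_aG : a \in G.
Proof.
have Wa : a \in W by apply: cycle_id.
by rewrite presented_GE; apply: subsetP Wa; apply: mulG_subr.
Qed.

Lemma presented_aNU : a \notin U.
Proof.
apply/negP=> Ua; have: a \in (U :&: W)%g by rewrite inE Ua; exact: cycle_id.
rewrite presented_tiUW => /set1gP a1.
have := presented_card pG.
have [U9 _] := card_eq; rewrite presented_GE.
by rewrite /Wgrp /= a1 cycle1 mulg1 U9.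
Qed.

End Structure.

Section Induced.

Variables (F : fieldType) (gT : finGroupType) (G H : {group gT}) (n : nat).
Variables (t : 'I_n -> gT) (rH : mx_representation F H 1).

Definition right_transversal : Prop :=
  [/\ H \subset G, forall i, t i \in G
    & forall g, g \in G -> exists! i, (g * (t i)^-1)%g \in H].

(* Representation of G induced by a representation rH of degree 1 of H,       *)
(* written in the basis of the induced module given by the transversal t.     *)
Definition induced_mx (g : gT) : 'M[F]_n :=
  \matrix_(i, j) (let h := (t i * g * (t j)^-1)%g in
                  if h \in H then rH h 0 0 else 0).

Lemma induced_mx_repr : right_transversal -> mx_repr G induced_mx.
Proof.
case=> sHG tG tT; split.
  apply/matrixP=> i j; rewrite !mxE /= mulg1.
  have [k [_ kU]] := tT _ (tG i).
  have Hii : (t i * (t i)^-1)%g \in H by rewrite mulgV group1.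
  have [<-|ij] := eqVneq i j; first by rewrite Hii mulgV repr_mx1 mxE.
  case: ifP => // Hij; move: ij.
  by rewrite -(kU _ Hii) -(kU _ Hij) eqxx.
move=> x y Gx Gy; apply/matrixP=> i k; rewrite !mxE.
have [j [Hj jU]] := tT _ (groupM (tG i) Gx).
rewrite (bigD1 j) //= big1 ?addr0 => [|l lj]; last first.
  rewrite !mxE /=; case: ifP => [Hl|]; last by rewrite mul0r.
  by rewrite (jU _ Hl) eqxx in lj.
have e : (t i * (x * y) * (t k)^-1 =
          (t i * x * (t j)^-1) * (t j * y * (t k)^-1))%g.
  by rewrite !mulgA mulgKV.
rewrite !mxE /= Hj e groupMl //; case: ifP => [Hk|]; last by rewrite mulr0.
by rewrite repr_mxM // mxE big_ord1.
Qed.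

Definition induced_repr (tT : right_transversal) : mx_representation F G n :=
  MxRepresentation (induced_mx_repr tT).

End Induced.

Section CompleteList.

Variables (F : fieldType) (gT : finGroupType) (G : {group gT}).

Definition complete_irr_list (L : seq {n : nat & mx_representation F G n}) :
    Prop :=
  (forall i : 'I_(size L), mx_irreducible (projT2 (tnth (in_tuple L) i))) /\
  (forall n (rG : mx_representation F G n), mx_irreducible rG ->
     exists! i : 'I_(size L), mx_rsim (projT2 (tnth (in_tuple L) i)) rG).

End CompleteList.

Section Representations.

Variable R : realType.

Definition cexp (z : R[i]) : R[i] :=
  ((expR (complex.Re z))%:C *
   (cos (complex.Im z) +i* sin (complex.Im z)))%C.

Definition omega : R[i] := cexp (0 +i* (2 * pi / 3))%C.

Lemma cexpD z1 z2 : cexp (z1 + z2) = cexp z1 * cexp z2.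
Proof.
case: z1 z2 => [r1 s1] [r2 s2]; rewrite /cexp /= expRD sinD cosD rmorphM /=.
rewrite mulrACA; congr (_ * _); apply/eqP; rewrite eq_complex /=.
by rewrite addrC eqxx [_ + sin s1 * _]addrC eqxx.
Qed.

Lemma omega3 : omega ^+ 3 = 1.
Proof.
rewrite !exprS expr0 mulr1 /omega -!cexpD /cexp /= !addr0 expR0 mul1r.
have ->: 2 * pi / 3 + (2 * pi / 3 + 2 * pi / 3) = pi *+ 2 :> R.
  by rewrite -mulrDl -mulrDl; field.
by rewrite cos2pi sin2pi.
Qed.

Variables (gT : finGroupType) (G : {group gT}) (x1 x2 a : gT).
Local Notation U := (Ugrp x1 x2).
Local Notation W := (Wgrp a).

(* Exponents (i, j) with u = x1 ^+ i * x2 ^+ j, for u in U.                   *)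
Definition coordU (u : gT) : 'Z_3 * 'Z_3 :=
  odflt (0, 0) [pick ij : 'Z_3 * 'Z_3 | u == (x1 ^+ ij.1 * x2 ^+ ij.2)%g].

Definition rho_mx (m1 m2 : 'Z_3) (u : gT) : 'M[R[i]]_1 :=
  (omega ^+ (m1 * (coordU u).1 + m2 * (coordU u).2)%R)%:M.

Definition sgnW (w : gT) : R[i] := if w == 1%g then 1 else -1.

(* [remgr U W g] is the W-component of g in G = U ><| W.                      *)
Definition Pi00_mx (k : nat) (g : gT) : 'M[R[i]]_1 :=
  (sgnW (remgr U W g) ^+ k)%:M.

Hypothesis pG : presented_by G x1 x2 a.

Lemma coordUE (i j : 'Z_3) : coordU (x1 ^+ i * x2 ^+ j)%g = (i, j).
Proof.
rewrite /coordU; case: pickP => [[i' j'] /= /eqP e|/(_ (i, j))]; last first.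
  by rewrite eqxx.
have ti := presented_tix pG; have [o1 o2] := presented_order pG.
have mx (y : gT) k : (y ^+ k)%g \in <[y]>%g by apply: mem_cycle.
have val_eq (y : gT) (k l : 'Z_3) :
    #[y]%g = 3%N -> (y ^+ k = y ^+ l)%g -> k = l.
  move=> oy /eqP; rewrite eq_expg_mod_order oy => /eqP kl; apply/val_inj.
  by rewrite /= -(modn_small (ltn_ord k)) -(modn_small (ltn_ord l)).
suff [-> ->] : i' = i /\ j' = j by [].
split.
  apply: (val_eq x1) => //.
  by rewrite -(divgrMid ti (mx x1 i') (mx x2 j')) -e (divgrMid ti).
apply: (val_eq x2) => //.
by rewrite -(remgrMid ti (mx x1 i') (mx x2 j')) -e (remgrMid ti).
Qed.

Lemma memUP u : u \in U -> exists i j : 'Z_3, u = (x1 ^+ i * x2 ^+ j)%g.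
Proof.
case: (pG) => _ _ x13 x23 _ _ _ _.
rewrite (presented_UE pG) => /mulsgP[_ _ /cycleP[i ->] /cycleP[j ->] ->].
exists (inZp i), (inZp j).
by congr (_ * _)%g; rewrite /= (@expg_mod _ 3).
Qed.

Lemma rho_mxE m1 m2 (i j : 'Z_3) :
  rho_mx m1 m2 (x1 ^+ i * x2 ^+ j)%g = (omega ^+ (m1 * i + m2 * j)%R)%:M.
Proof. by rewrite /rho_mx coordUE. Qed.

Let omegaD (x y : 'Z_3) : omega ^+ (x + y)%R = omega ^+ x * omega ^+ y.
Proof. by rewrite -exprD; exact: (expr_mod _ omega3). Qed.

Lemma rho_mx_repr m1 m2 : mx_repr U (rho_mx m1 m2).
Proof.
split=> [|u v /memUP[i [j ->]] /memUP[i' [j' ->]]].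
  have := rho_mxE m1 m2 0 0.
  by rewrite !mulr0 addr0 !expg0 mulg1 expr0.
have e : (x1 ^+ i * x2 ^+ j * (x1 ^+ i' * x2 ^+ j') =
          x1 ^+ (i + i')%R * x2 ^+ (j + j')%R)%g.
  case: (pG) => _ _ x13 x23 x12 _ _ _.
  rewrite /= !(@expg_mod _ 3) // !expgD !mulgA; congr (_ * _)%g.
  by rewrite -!mulgA; congr (_ * _)%g; apply: commuteX2.
rewrite e !rho_mxE -scalar_mxM; congr (_%:M).
by rewrite -omegaD; congr (omega ^+ _); rewrite !mulrDr addrACA.
Qed.

Definition rho (m1 m2 : 'Z_3) : mx_representation R[i] U 1 :=
  MxRepresentation (rho_mx_repr m1 m2).

Lemma rho_x1 m1 m2 : rho m1 m2 x1 0 0 = omega ^+ m1.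
Proof.
have := rho_mxE m1 m2 1 0; rewrite mulr0 mulr1 addr0 mulg1 expg1 /= => ->.
by rewrite mxE.
Qed.

Lemma rho_x2 m1 m2 : rho m1 m2 x2 0 0 = omega ^+ m2.
Proof.
have := rho_mxE m1 m2 0 1; rewrite mulr0 mulr1 add0r mul1g expg1 /= => ->.
by rewrite mxE.
Qed.

Lemma Pi00_mx_repr k : mx_repr G (Pi00_mx k).
Proof.
have [_ _ nUW tiUW] := sdprodP (presented_sdprod pG).
split=> [|x y Gx Gy].
  by rewrite /Pi00_mx remgr1 // /sgnW eqxx expr1n.
have cplW : W \in [complements to U in G].
  by apply/complP; split; rewrite ?(presented_GE pG).
have nsU : U <| G by rewrite (presented_GE pG) -norm_joinEr // normalYl.
rewrite /Pi00_mx (remgrM cplW nsU) // -scalar_mxM -exprMn; congr (_ ^+ _)%:M.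
have WP z : z \in G -> remgr U W z = 1%g \/ remgr U W z = a.
  rewrite {1}(presented_GE pG) => /mem_remgr /cycleP[i ->].
  rewrite -(odd_double_half i) expgD -mul2n expgM.
  by case: pG => _ -> *; rewrite expg1n mulg1; case: (odd i); [right|left].
have aN1 : a != 1%g.
  by apply: contraNneq (presented_aNU pG) => ->; rewrite group1.
have aa : (a * a = 1)%g by case: pG.
rewrite /sgnW; have [->|->] := WP x Gx; have [->|->] := WP y Gy;
  rewrite ?mul1g ?mulg1 ?aa ?eqxx ?(negPf aN1) ?mulr1 ?mul1r //.
by rewrite mulrNN mulr1.
Qed.

Definition Pi00 (k : nat) : mx_representation R[i] G 1 :=
  MxRepresentation (Pi00_mx_repr k).

Lemma Pi00_U k u : u \in U -> Pi00 k u = 1%:M.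
Proof. by move=> Uu; rewrite /= /Pi00_mx remgr1 // /sgnW eqxx expr1n. Qed.

Lemma Pi00_a k : Pi00 k a = ((-1) ^+ k)%:M.
Proof.
have Wa : a \in W by apply: cycle_id.
have e := remgr_id (presented_tiUW pG) Wa.
rewrite -[Pi00 k a]/(Pi00_mx k a) /Pi00_mx e /sgnW ifN //.
by apply: contraNneq (presented_aNU pG) => ->; rewrite group1.
Qed.

Lemma UW_transversal : right_transversal G U (fun i : 'I_2 => (a ^+ i)%g).
Proof.
have aN := presented_aNU pG; have aV := presented_aV pG.
have aa : (a * a = 1)%g by case: pG.
split=> [|i|g]; first exact: presented_sUG pG.
  by rewrite groupX ?(presented_aG pG).
rewrite (presented_GE pG) => /mulsgP[u _ Uu /cycleP[k ->] ->].
have -> : (a ^+ k = a ^+ odd k)%g.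
  rewrite -{1}(odd_double_half k) expgD -mul2n expgM.
  by case: pG => _ -> *; rewrite expg1n mulg1.
exists (inord (odd k)); split=> [|j]; first by rewrite inordK ?mulgK; case: odd.
move=> Uj; apply/val_inj; rewrite /= inordK; last by case: odd.
move: Uj; rewrite -mulgA groupMl //.
by case: (odd k) j => -[[|[|?]] ?] //=;
   rewrite ?expg0 ?expg1 ?mul1g ?invg1 ?mulg1 ?aV (negPf aN).
Qed.

Definition Pi (m1 m2 : 'Z_3) : mx_representation R[i] G 2 :=
  induced_repr (rho m1 m2) UW_transversal.

Lemma rhoV m1 m2 u : u \in U -> rho m1 m2 u^-1%g = rho (- m1) (- m2) u.
Proof.
move=> Uu; have e : rho m1 m2 u *m rho (- m1) (- m2) u = 1%:M.
  have [i [j ->]] := memUP Uu.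
  rewrite /= !rho_mxE -scalar_mxM -omegaD; congr (_%:M).
  by rewrite !mulNr -opprD subrr expr0.
rewrite -[LHS]mulmx1 -e mulmxA -repr_mxM ?groupV // mulVg repr_mx1.
by rewrite mul1mx.
Qed.

Lemma Pi_U m1 m2 u : u \in U ->
  Pi m1 m2 u =
  diag_mx (\row_i if i == 0 then rho m1 m2 u 0 0 else rho (- m1) (- m2) u 0 0).
Proof.
move=> Uu; have ca := presented_conj pG Uu; have rV := rhoV m1 m2 Uu.
move: ca (presented_aNU pG) rV Uu.
rewrite -[Pi m1 m2 u]/(induced_mx (fun i : 'I_2 => (a ^+ i)%g) (rho m1 m2) u).
move: (rho m1 m2) (rho (- m1) (- m2)); move: (Ugrp x1 x2) => H r r' ca aN rV Hu.
apply/matrixP=> i j; rewrite !mxE.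
case: i j => [[|[|?]] ?] [[|[|?]] ?] //=;
  rewrite ?expg0 ?expg1 ?mul1g ?invg1 ?mulg1 ?mulr1n.
- by rewrite Hu.
- by rewrite groupMl // groupV (negPf aN).
- by rewrite groupMr // (negPf aN).
by rewrite ca groupV Hu rV.
Qed.

Lemma Pi_a m1 m2 : Pi m1 m2 a = \matrix_(i, j) (i != j)%:R.
Proof.
have aa : (a * a = 1)%g by case: pG.
move: (presented_aNU pG).
rewrite -[Pi m1 m2 a]/(induced_mx (fun i : 'I_2 => (a ^+ i)%g) (rho m1 m2) a).
move: (rho m1 m2); move: (Ugrp x1 x2) => H r aN.
apply/matrixP=> i j; rewrite !mxE.
case: i j => [[|[|?]] ?] [[|[|?]] ?] //=;
  rewrite ?expg0 ?expg1 ?mul1g ?invg1 ?mulg1.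
- by rewrite (negPf aN).
- by rewrite mulgV group1 repr_mx1 mxE.
- by rewrite aa group1 repr_mx1 mxE.
by rewrite mulgK (negPf aN).
Qed.

End Representations.

(* Main.v *)
(* Restricted to the abelian group U, an irreducible representation of G has *)
(* a common eigenvector v, on which U acts by some rho_m. If m <> 0, then    *)
(* Frobenius reciprocity turns v into a nonzero morphism from Pi_m, which is *)
(* an isomorphism by Schur's lemma; the image of v under a has weight -m, so *)
(* m matters only up to sign. If m = 0, then v + av or v - av spans one of   *)
(* the two representations of degree 1. The Pi_m are told apart by their     *)
(* kernels in U, which are orthogonal to m.                                  *)

Require Import Defs.
From mathcomp Require Import all_boot all_algebra all_fingroup mxrepresentation.
From mathcomp Require Import complex reals.
From mathcomp Require Import all_order exp trigo ring lra.

Set Implicit Arguments.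
Unset Strict Implicit.
Unset Printing Implicit Defensive.

Import Order.TTheory GRing.Theory Num.Theory.

Local Open Scope ring_scope.

(** Restriction to [U] reduces the classification to characters m of C_3 x C_3 up to sign.
    [weight_exists] finds such an m in any irreducible representation, and [irr_rsim_cases]
    identifies the representation from it; [weight_a] gives the symmetry between m and -m. The eight
    nonzero m form four pairs {m, -m}, one for each line of Z_3^2, and the list takes one from each.
    [Pi_rsim] separates the lines, [Pi00_rsim] the two signs, and the degree separates the two
    kinds. *)

(** * Schur's lemma, Frobenius reciprocity and the cube root of unity *)

(** Schur: the kernel of [B] is a proper submodule, hence zero, and its image is a nonzero one,
    hence everything; comparing ranks also gives [n1 = n2]. *)
Lemma mx_irr_hom_rsim (F : fieldType) (gT : finGroupType) (G : {group gT})
    (n1 n2 : nat) (rG1 : mx_representation F G n1)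
    (rG2 : mx_representation F G n2) (B : 'M_(n1, n2)) :
  mx_irreducible rG1 -> mx_irreducible rG2 -> B != 0 ->
  (forall x, x \in G -> rG1 x *m B = B *m rG2 x) -> mx_rsim rG1 rG2.
Proof.
move=> /mx_irrP[_ irr1] /mx_irrP[_ irr2] nzB homB.
have freeB : row_free B.
  rewrite -kermx_eq0; apply: contraNT nzB => nzK.
  have modK : mxmodule rG1 (kermx B).
    apply/mxmoduleP=> x Gx; apply/sub_kermxP.
    by rewrite -mulmxA homB // mulmxA mulmx_ker mul0mx.
  have /row_fullP[K' K'K] := irr1 _ modK nzK.
  by rewrite -[B]mul1mx -K'K -mulmxA mulmx_ker mulmx0.
have fullB : row_full <<B>>%MS.
  apply: irr2; last by rewrite -submx0 genmxE submx0.
  apply/mxmoduleP=> x Gx; rewrite (eqmxMr _ (genmxE B)) genmxE -homB //.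
  exact: submxMl.
exists B => //.
by rewrite -[LHS](eqP freeB) -[RHS](eqP fullB) genmxE.
Qed.

(* Frobenius reciprocity, for the induction of a character of degree 1. *)
Lemma induced_repr_hom (F : fieldType) (gT : finGroupType) (G H : {group gT})
    (k n : nat) (t : 'I_k -> gT) (rH : mx_representation F H 1)
    (tT : right_transversal G H t) (rG : mx_representation F G n) (v : 'rV_n) :
  (forall h, h \in H -> v *m rG h = rH h 0 0 *: v) ->
  forall x, x \in G ->
  induced_repr rH tT x *m (\matrix_i (v *m rG (t i)))
  = (\matrix_i (v *m rG (t i))) *m rG x.
Proof.
move=> vH x Gx; have [sHG tG tU] := tT.
apply/row_matrixP=> i; rewrite !row_mul rowK mulmx_sum_row.
have [j [Hj jU]] := tU _ (groupM (tG i) Gx).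
rewrite (bigD1 j) //= big1 => [|l lj]; last first.
  rewrite !mxE /=; case: ifP => [Hl|]; last by rewrite scale0r.
  by rewrite (jU _ Hl) eqxx in lj.
rewrite !mxE /= Hj addr0 rowK -!mulmxA -repr_mxM //.
rewrite -[in RHS](mulgKV (t j) (t i * x)%g).
rewrite (repr_mxM rG) ?groupM ?groupV // mulmxA [in RHS]vH //.
by rewrite -[in RHS]scalemxAl.
Qed.

Lemma omega_prim (R : realType) : 3.-primitive_root (omega R).
Proof.
have [m prim_m m3] := prim_order_exists (isT : 0 < 3)%N (omega3 R).
(* Order 1 is excluded because the imaginary part of [omega] is sin(2 pi / 3), which is positive. *)
have /primeP[_ /(_ m m3) /orP[]/eqP m_eq] := isT : prime 3; last first.
  by rewrite m_eq in prim_m.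
have := prim_expr_order prim_m; rewrite m_eq expr1 => /(congr1 (@complex.Im R)).
have : 0 < sin (2 * pi / 3) :> R.
  apply: sin_gt0_pi; have := pi_gt0 R; lra.
rewrite /omega /cexp /= expR0 mul1r; lra.
Qed.

(** * Inequivalence and irreducibility of the listed representations *)

Section Dihedral.

Variables (R : realType) (gT : finGroupType) (G : {group gT}).
Variables (x1 x2 a : gT) (pG : presented_by G x1 x2 a).
Local Notation U := (Ugrp x1 x2).
Local Notation Pi := (Pi R pG).
Local Notation rho := (rho R pG).
Local Notation Pi00 := (Pi00 R pG).

Let inU (i j : 'Z_3) : (x1 ^+ i * x2 ^+ j)%g \in U.
Proof. by rewrite (presented_UE pG) mem_mulg ?mem_cycle. Qed.

Let sUG u : u \in U -> u \in G.
Proof. exact: subsetP (presented_sUG pG) u. Qed.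

Lemma omegaX_eq (i j : 'Z_3) : (omega R ^+ i == omega R ^+ j) = (i == j).
Proof.
by rewrite (eq_prim_root_expr (omega_prim R)) !modn_small ?ltn_ord.
Qed.

Lemma Pi_kernel (m1 m2 i j : 'Z_3) :
  Pi m1 m2 (x1 ^+ i * x2 ^+ j)%g = 1%:M <-> m1 * i + m2 * j = 0.
Proof.
rewrite Pi_U //= !(rho_mxE _ pG).
split=> [/matrixP/(_ 0 0)|mij0].
  rewrite !mxE /= !mulr1n => e; apply/eqP; rewrite -omegaX_eq.
  exact/eqP.
rewrite -[RHS]diag_const_mx; congr diag_mx; apply/rowP=> k.
by rewrite !mxE !mulNr -opprD mij0 oppr0 expr0 if_same.
Qed.

(** The vector [(- m2, m1)] is orthogonal to m, so it gives an element of the kernel of [Pi m1 m2],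
    which equivalent representations share. The conclusion is a vanishing determinant: m and n are
    linearly dependent. *)
Lemma Pi_rsim (m1 m2 n1 n2 : 'Z_3) :
  mx_rsim (Pi m1 m2) (Pi n1 n2) -> m1 * n2 = m2 * n1.
Proof.
move=> sim; have /Pi_kernel e : m1 * - m2 + m2 * m1 = 0 by ring.
have /Pi_kernel/eqP : Pi n1 n2 (x1 ^+ (- m2)%R * x2 ^+ m1)%g = 1%:M.
  by apply: mx_rsim_scalar sim e; rewrite sUG ?inU.
by rewrite mulrN addrC subr_eq0 mulrC [n1 * _]mulrC => /eqP.
Qed.

Lemma Pi00_rsim (k l : 'I_2) : mx_rsim (Pi00 k) (Pi00 l) -> k = l.
Proof.
move/(mx_rsim_scalar (presented_aG pG))/(_ (Pi00_a R pG k)).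
rewrite Pi00_a => /matrixP/(_ 0 0); rewrite !mxE !mulr1n => e.
have odd_ord (i : 'I_2) : odd i = i :> nat by case: i => [[|[|?]] ?].
apply/val_inj; rewrite /= -[LHS]odd_ord -[RHS]odd_ord; congr (nat_of_bool _).
by apply: (@signr_inj R[i]); rewrite /= !odd_ord.
Qed.

Lemma Pi_irr (m1 m2 : 'Z_3) : (m1, m2) != 0 -> mx_irreducible (Pi m1 m2).
Proof.
move=> nz_m; apply/mx_irrP; split=> // V modV.
have [i [j nz_ij]] : exists i j : 'Z_3, m1 * i + m2 * j != 0.
  have [m10|] := eqVneq m1 0; last by exists 1, 0; rewrite mulr1 mulr0 addr0.
  exists 0, 1; rewrite mulr1 mulr0 add0r; apply: contraNneq nz_m => ->.
  by rewrite m10.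
set u := (x1 ^+ i * x2 ^+ j)%g.
pose l : R[i] := omega R ^+ (m1 * i + m2 * j)%R.
pose l' : R[i] := omega R ^+ (- (m1 * i + m2 * j))%R.
(* Equality would force s = -s for a nonzero s in Z_3. *)
have ll' : l - l' != 0.
  rewrite subr_eq0 omegaX_eq; move: nz_ij.
  by case: (m1 * i + m2 * j) => [[|[|[|?]]] ?].
have PiuE : Pi m1 m2 u = diag_mx (\row_k if k == 0 then l else l').
  rewrite Pi_U ?inU //= !(rho_mxE _ pG); congr diag_mx; apply/rowP=> k.
  by rewrite !mxE !mulr1n !mulNr -opprD.
have Vg g (v : 'rV_2) : g \in G -> (v <= V -> v *m Pi m1 m2 g <= V)%MS.
  move=> Gg Vv; apply: submx_trans (submxMr _ Vv) _.
  exact: (mxmoduleP modV).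
have row_a (k : 'I_2) :
    delta_mx 0 k *m Pi m1 m2 a = delta_mx 0 (rev_ord k) :> 'rV[R[i]]_2.
  rewrite Pi_a -rowE; apply/rowP=> l0; rewrite !mxE /=.
  by case: k l0 => [[|[|?]] ?] [[|[|?]] ?].
have full k : ((delta_mx 0 k : 'rV_2) <= V)%MS -> row_full V.
  move=> Vk; have := Vg a _ (presented_aG pG) Vk; rewrite row_a => Vk'.
  rewrite -sub1mx; apply/row_subP=> k'; rewrite row1.
  have [->//|k'k] := eqVneq k' k; suff -> : k' = rev_ord k by [].
  apply/val_inj.
  by case: k k' k'k {Vk Vk'} => [[|[|?]] ?] [[|[|?]] ?].
case/rowV0Pn=> v Vv nzv.
have Vd c : (v *m Pi m1 m2 u - c *: v <= V)%MS.
  by rewrite addmx_sub ?Vg ?sUG ?inU // -scaleNr scalemx_sub.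
have [k nzk] : exists k, v 0 k != 0.
  apply/existsP; apply: contraNT nzv => /existsPn nz; apply/eqP/rowP=> k.
  by rewrite mxE; apply/eqP/negbNE.
(* [c] is the eigenvalue of [u] on the other coordinate, so subtracting [c *: v] leaves a nonzero
   multiple of the basis vector [k]; [a] swaps it with the other one. *)
apply: (full k); pose c := if k == 0 then l' else l.
have := Vd c.
have -> : v *m Pi m1 m2 u - c *: v
        = (v 0 k * (if k == 0 then l - l' else l' - l)) *: delta_mx 0 k.
  apply/rowP=> k'; rewrite PiuE mul_mx_diag !mxE /c /=.
  have [->|k'k] := eqVneq k' k; first by case: (k == 0) => /=; ring.
  have -> : (k' == 0) = ~~ (k == 0).
    by case: k k' k'k {c nzk} => [[|[|?]] ?] [[|[|?]] ?].
  by case: (k == 0) => /=; ring.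
rewrite eqmx_scale // mulf_neq0 //; case: ifP => // _.
by rewrite -opprB oppr_eq0.
Qed.

(** * Weights of [U] in an arbitrary irreducible representation *)

Section Weights.

Variables (n : nat) (rG : mx_representation R[i] G n).
Hypothesis irrG : mx_irreducible rG.

Definition weight (m1 m2 : 'Z_3) (v : 'rV[R[i]]_n) :=
  forall u, u \in U -> v *m rG u = rho m1 m2 u 0 0 *: v.

(** Commuting matrices over an algebraically closed field have a common eigenvector; since x1 and x2
    have cube 1, their eigenvalues are powers of [omega]. *)
Lemma weight_exists : exists m1 m2 v, v != 0 /\ weight m1 m2 v.
Proof.
have [n_gt0 _] := (mx_irrP rG).1 irrG.
have x1U : x1 \in U by have := inU 1 0; rewrite mulg1.
have x2U : x2 \in U by have := inU 0 1; rewrite mul1g.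
have cX : rG x1 *m rG x2 = rG x2 *m rG x1.
  by rewrite -!repr_mxM ?sUG //; case: pG => _ _ _ _ ->.
have [v nzv /andP[/sub_rVP[l1 e1] /sub_rVP[l2 e2]]] :=
  common_eigenvector2 n_gt0 cX.
have eX x l k : x \in G -> v *m rG x = l *: v ->
    v *m rG (x ^+ k)%g = l ^+ k *: v.
  move=> Gx e; elim: k => [|k IHk]; first by rewrite repr_mx1 mulmx1 scale1r.
  by rewrite expgSr repr_mxM ?groupX // mulmxA IHk -scalemxAl e scalerA exprSr.
have root x l : x \in G -> (x ^+ 3 = 1)%g -> v *m rG x = l *: v ->
    exists m : 'Z_3, l = omega R ^+ m.
  move=> Gx x3 e; suff /(prim_rootP (omega_prim R))[m ->] : l ^+ 3 = 1.
    by exists m.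
  have := eX x l 3 Gx e; rewrite x3 repr_mx1 mulmx1 -{1}[v]scale1r => /eqP.
  by rewrite -subr_eq0 -scalerBl scaler_eq0 (negPf nzv) orbF subr_eq0 => /eqP.
case: (pG) => _ _ x13 x23 _ _ _ _.
have [m1 l1E] := root _ _ (sUG x1U) x13 e1.
have [m2 l2E] := root _ _ (sUG x2U) x23 e2.
exists m1, m2, v; split=> // u /(memUP pG)[i [j ->]].
rewrite repr_mxM ?groupX ?sUG // mulmxA (eX _ l1) ?sUG // -scalemxAl.
rewrite (eX _ l2) ?sUG // scalerA /= (rho_mxE _ pG) mxE mulr1n l1E l2E.
rewrite -!exprM -exprD -[LHS]/(omega R ^+ _ *: v); congr (_ *: v).
by rewrite -[LHS](expr_mod _ (omega3 R)) /= modnDml modnDmr.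
Qed.

(** Conjugation by [a] inverts [U]. *)
Lemma weight_a m1 m2 v : weight m1 m2 v -> weight (- m1) (- m2) (v *m rG a).
Proof.
move=> wv u Uu; have Ga := presented_aG pG.
rewrite -mulmxA -repr_mxM ?Ga ?sUG //.
have -> : (a * u = u^-1 * a)%g by rewrite -(presented_conj pG Uu) mulgKV.
rewrite (repr_mxM rG) ?Ga ?groupV ?sUG // mulmxA wv ?groupV // rhoV //.
by rewrite -scalemxAl.
Qed.

Lemma weight_Pi m1 m2 v :
  (m1, m2) != 0 -> v != 0 -> weight m1 m2 v -> mx_rsim (Pi m1 m2) rG.
Proof.
move=> nzm nzv wv.
apply: mx_irr_hom_rsim (Pi_irr nzm) irrG _ (induced_repr_hom _ wv).
(* The transversal starts with [a ^+ 0 = 1], so row 0 of the Frobenius morphism is [v] itself. *)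
apply: contraNneq nzv => /row_matrixP/(_ 0).
by rewrite rowK row0 /= expg0 repr_mx1 mulmx1 => ->.
Qed.

Lemma weight0_Pi00 k v :
  v != 0 -> weight 0 0 v -> v *m rG a = (-1) ^+ k *: v -> mx_rsim (Pi00 k) rG.
Proof.
move=> nzv wv va.
(* The row [v], as a 1 x n matrix, is the nonzero morphism. *)
apply: mx_irr_hom_rsim irrG nzv _; first exact/mx_abs_irrW/linear_mx_abs_irr.
move=> x; rewrite {1}(presented_GE pG) => /mulsgP[u _ Uu /cycleP[i ->] ->].
have Ga := presented_aG pG.
rewrite !repr_mxM ?groupX ?Ga ?sUG // Pi00_U // mul1mx mulmxA wv //.
have -> : rho 0 0 u 0 0 = 1.
  have [i0 [j0 ->]] := memUP pG Uu.
  by rewrite /= (rho_mxE _ pG) !mul0r addr0 mxE mulr1n.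
rewrite scale1r.
elim: i => [|i IHi]; first by rewrite !repr_mx1 mulmx1 mul1mx.
rewrite !expgS !repr_mxM ?groupX // Pi00_a mul_scalar_mx -scalemxAl IHi.
by rewrite mulmxA va -scalemxAl.
Qed.

(** Both signs are recorded because the list contains only one of m and -m. *)
Lemma irr_rsim_cases :
  (exists k : 'I_2, mx_rsim (Pi00 k) rG) \/
  exists m1 m2, [/\ (m1, m2) != 0, mx_rsim (Pi m1 m2) rG
                  & mx_rsim (Pi (- m1) (- m2)) rG].
Proof.
have Ga := presented_aG pG; have aa : (a * a = 1)%g by case: (pG).
have aK v : v *m rG a *m rG a = v.
  by rewrite -mulmxA -repr_mxM // aa repr_mx1 mulmx1.
have [m1 [m2 [v [nzv wv]]]] := weight_exists; have wva := weight_a wv.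
have [m0|nzm] := eqVneq (m1, m2) 0; last first.
  right; exists m1, m2; split=> //; first exact: weight_Pi wv.
  apply: weight_Pi wva; first by rewrite -oppr_eq0 in nzm.
  by apply: contraNneq nzv => e; rewrite -[v]aK e mul0mx.
move: m0 wv wva => [-> ->]; rewrite oppr0 => wv wva; left.
(* [a] fixes this sum; if the sum vanishes, [a] negates [v]. *)
have [s0|nzs] := eqVneq (v + v *m rG a) 0.
  exists 1; apply: (@weight0_Pi00 _ v) => //.
  by rewrite expr1 scaleN1r; apply/eqP; rewrite -addr_eq0 addrC s0.
exists 0; apply: (@weight0_Pi00 _ (v + v *m rG a)) => //.
  by move=> u Uu; rewrite mulmxDl wv // wva // -scalerDr.
by rewrite mulmxDl aK addrC expr0 scale1r.
Qed.

End Weights.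

End Dihedral.

Theorem theorem5p1 (R : realType) (gT : finGroupType) (G : {group gT})
    (x1 x2 a : gT) (pG : presented_by G x1 x2 a) :
  #|G| = 18%N /\
  complete_irr_list
    [:: existT _ 1%N (Pi00 R pG 0); existT _ 1%N (Pi00 R pG 1);
        existT _ 2%N (Pi R pG 1 1); existT _ 2%N (Pi R pG 1 0);
        existT _ 2%N (Pi R pG 1 (-1)); existT _ 2%N (Pi R pG 0 1)].
Proof.
split; first exact: presented_card pG.
split=> [|n rG irrG].
  case=> -[|[|[|[|[|[|//]]]]]] lti; do 1?[exact: Pi_irr];
    exact/mx_abs_irrW/linear_mx_abs_irr.
set L := (X in in_tuple X).
have uniqL (i j : 'I_(size L)) :
    mx_rsim (projT2 (tnth (in_tuple L) i)) (projT2 (tnth (in_tuple L) j)) ->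
    i = j.
  (* Distinct positions differ in degree, or have linearly independent m, or differ in the sign at
     [a]. *)
  case: i j => [[|[|[|[|[|[|//]]]]]] lti] [[|[|[|[|[|[|//]]]]]] ltj] sim;
    try exact: val_inj; exfalso;
    first [ by have := mxrank_rsim sim | by have := Pi_rsim sim
          | by have := @Pi00_rsim _ _ _ _ _ _ pG 0 1 sim
          | by have := @Pi00_rsim _ _ _ _ _ _ pG 1 0 sim ].
suff [i sim] :
    exists i : 'I_(size L), mx_rsim (projT2 (tnth (in_tuple L) i)) rG.
  exists i; split=> // j simj; apply: uniqL.
  exact: mx_rsim_trans sim (mx_rsim_sym simj).
have PiL m1 m2 : (m1, m2) \in [:: (1, 1); (1, 0); (1, -1); (0, 1)] ->
    mx_rsim (Pi R pG m1 m2) rG ->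
    exists i : 'I_(size L), mx_rsim (projT2 (tnth (in_tuple L) i)) rG.
  rewrite !inE => /or4P[]/eqP[-> ->] sim.
  - by exists (@Ordinal (size L) 2 isT).
  - by exists (@Ordinal (size L) 3 isT).
  - by exists (@Ordinal (size L) 4 isT).
  - by exists (@Ordinal (size L) 5 isT).
have [[[[|[|//]] lt2] sim]|[m1 [m2 [nzm sim simN]]]] := irr_rsim_cases pG irrG.
- by exists (@Ordinal (size L) 0 isT).
- by exists (@Ordinal (size L) 1 isT).
have [/PiL|notL] := boolP ((m1, m2) \in [:: (1, 1); (1, 0); (1, -1); (0, 1)]).
  by apply.
(* A nonzero m off the list has -m on it. *)
apply: PiL simN; move: nzm notL.
by case: m1 m2 {sim} => [[|[|[|?]]] ?] [[|[|[|?]]] ?].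
Qed.
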